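(* Let $\Lambda$ be a finite dimensional algebra over a field $K$ and let $\frac{A}{B}$ be a balanced pair over $\Lambda$. Then the dual of $J\left(\frac{A}{B}\right)$ is $J\left(\frac{DB}{DA}\right)$; i.e. for a $\Lambda$-module $X$, $X\in J\left(\frac{A}{B}\right)$ if and only if $DX\in J\left(\frac{DB}{DA}\right)$.
   Context: Modules are finitely generated right modules. $D=\mathrm{Hom}_K(-,K)$ is the duality from right $\Lambda$-modules to right $\Lambda^{op}$-modules. A pair of modules $\frac{A}{B}$ is a balanced pair if $\mathrm{Hom}_\Lambda(A,B)=0$, $B\cong\tau A\sqcup I$ with $I$ injective, and $A\cong\tau^{-1}B\sqcup P$ with $P$ projective ($\tau$ the Auslander-Reiten translate). If $\frac{A}{B}$ is a balanced pair over $\Lambda$ then $\frac{DB}{DA}$ is a balanced pair over $\Lambda^{op}$. The Jasso category of a balanced pair is $J\left(\frac{A}{B}\right)=A^\perp\cap{}^\perp B=\{X:\mathrm{Hom}(A,X)=0=\mathrm{Hom}(X,B)\}$. *)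

(* Defs.v *)
From HB Require Import structures.
From mathcomp Require Import all_boot all_order all_algebra all_field.
From mathcomp Require Import boolp functions.

Set Implicit Arguments.
Unset Strict Implicit.
Unset Printing Implicit Defensive.

Import GRing.Theory.
Local Open Scope ring_scope.

(* A right module over a ring L is a left module over the converse ring L^c:
   [x . a] is [(a : L^c) *: x].  The opposite algebra of L is L^c, so that a
   right module over it is an [lmodType L^c^c].  Below, everything is written
   for left modules over a ring R; right L-modules are the case R = L^c. *)

Section OppositeAlgebra.
Variable K : fieldType.

HB.instance Definition _ (L : algType K) := GRing.Lmodule.copy L^c L.

Fact converse_scalerAl (L : algType K) (k : K) (a b : L^c) :
  k *: (a * b) = (k *: a : L^c) * b.
Proof. exact: (@scalerAr K L k b a). Qed.

HB.instance Definition _ (L : algType K) :=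
  GRing.Lmodule_isLalgebra.Build K L^c (@converse_scalerAl L).

Fact converse_scalerAr (L : algType K) (k : K) (a b : L^c) :
  k *: (a * b) = a * (k *: b : L^c).
Proof. exact: (@scalerAl K L k b a). Qed.

HB.instance Definition _ (L : algType K) :=
  GRing.Lalgebra_isAlgebra.Build K L^c (@converse_scalerAr L).

HB.instance Definition _ (L : falgType K) := Vector.copy L^c L.

End OppositeAlgebra.

Section LinearMaps.
Variables (R : pzRingType) (U V : lmodType R).

Definition is_linear : pred (U -> V) := fun f => `[< linear f >].

Record linmap := LinMap { linmap_fun :> U -> V; _ : is_linear linmap_fun }.

HB.instance Definition _ := [isSub for linmap_fun].
HB.instance Definition _ := [Choice of linmap by <:].

Lemma linmapP (f : linmap) : linear f.
Proof. by case: f => f /= /asboolP. Qed.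

HB.instance Definition _ (f : linmap) :=
  GRing.isLinear.Build R U V _ (linmap_fun f) (linmapP f).

Fact linmap_zmod_closed : zmod_closed is_linear.
Proof.
split=> [|f g /asboolP lf /asboolP lg]; apply/asboolP => a x y /=.
  by rewrite scaler0 addr0.
rewrite -[LHS]/(f (a *: x + y) - g (a *: x + y)) lf lg.
by rewrite -[RHS]/(a *: (f x - g x) + (f y - g y)) scalerBr opprD addrACA.
Qed.

HB.instance Definition _ :=
  GRing.isZmodClosed.Build (U -> V) is_linear linmap_zmod_closed.
HB.instance Definition _ := [SubChoice_isSubZmodule of linmap by <:].

End LinearMaps.

Section ModuleProperties.
Variable R : pzRingType.

Definition surjective (U V : Type) (f : U -> V) := forall v, exists u, f u = v.

Definition fin_gen (M : lmodType R) : Prop :=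
  exists n (g : 'I_n -> M),
    forall x, exists a : 'I_n -> R, x = \sum_(i < n) a i *: g i.

Definition isomorphic (M N : lmodType R) : Prop :=
  exists f : {linear M -> N}, bijective f.

Definition hom_zero (M N : lmodType R) : Prop :=
  forall (f : {linear M -> N}) x, f x = 0.

Definition projective (P : lmodType R) : Prop :=
  fin_gen P /\
  forall (M N : lmodType R) (g : {linear M -> N}) (f : {linear P -> N}),
    fin_gen M -> fin_gen N -> surjective g ->
    exists h : {linear P -> M}, forall x, g (h x) = f x.

Definition injective_module (I : lmodType R) : Prop :=
  fin_gen I /\
  forall (M N : lmodType R) (g : {linear M -> N}) (f : {linear M -> I}),
    fin_gen M -> fin_gen N -> injective g ->
    exists h : {linear N -> I}, forall x, h (g x) = f x.

(* [f] is a projective cover of its image: [P] is projective and [f] is an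
   essential epimorphism onto its image, i.e. [g] is onto as soon as [f \o g]
   has the same image as [f]. *)
Definition projective_cover_onto_image (P M : lmodType R)
    (f : {linear P -> M}) : Prop :=
  projective P /\
  forall (X : lmodType R) (g : {linear X -> P}), fin_gen X ->
    (forall p, exists x, f (g x) = f p) -> surjective g.

(* P1 -p1-> P0 -p0-> M -> 0 *)
Definition minimal_projective_presentation (P1 P0 M : lmodType R)
    (p1 : {linear P1 -> P0}) (p0 : {linear P0 -> M}) : Prop :=
  [/\ surjective p0,
      forall y, p0 y = 0 <-> exists x, p1 x = y,
      projective_cover_onto_image p0 &
      projective_cover_onto_image p1].

End ModuleProperties.

Section RestrictedScalars.
Variables (K : fieldType) (R : algType K).

Definition restrict_scalars (M : lmodType R) : Type := M.
HB.instance Definition _ (M : lmodType R) :=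
  GRing.Zmodule.on (restrict_scalars M).

Variable M : lmodType R.
Let scale (k : K) (x : restrict_scalars M) : restrict_scalars M :=
  (k%:A : R) *: (x : M).

Fact restrict_scalerA a b x : scale a (scale b x) = scale (a * b) x.
Proof. by rewrite /scale scalerA -scalerAl mul1r scalerA. Qed.
Fact restrict_scale1r : left_id 1 scale.
Proof. by move=> x; rewrite /scale !scale1r. Qed.
Fact restrict_scalerDr : right_distributive scale +%R.
Proof. by move=> a x y; rewrite /scale scalerDr. Qed.
Fact restrict_scalerDl x : {morph scale^~ x : a b / a + b}.
Proof. by move=> a b; rewrite /scale !scalerDl. Qed.

HB.instance Definition _ := GRing.Zmodule_isLmodule.Build K (restrict_scalars M)
  restrict_scalerA restrict_scale1r restrict_scalerDr restrict_scalerDl.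

End RestrictedScalars.

(* D M = Hom_K(M, K), with (a f)(x) = f(a x) for a : R^c *)
Section Duality.
Variables (K : fieldType) (R : algType K).

Definition dual (M : lmodType R) : Type := linmap (restrict_scalars M) K^o.
HB.instance Definition _ (M : lmodType R) := GRing.Zmodule.on (dual M).

Variable M : lmodType R.

Fact dual_scale_subproof (a : R^c) (f : dual M) :
  `[< linear (fun x : restrict_scalars M => f ((a : R) *: (x : M)) : K^o) >].
Proof.
apply/asboolP => k x y; rewrite -linearP; congr (linmap_fun f _).
change ((a : R) *: ((k%:A : R) *: (x : M) + (y : M)) =
        (k%:A : R) *: ((a : R) *: (x : M)) + (a : R) *: (y : M)).
by rewrite scalerDr !scalerA -scalerAl mul1r -scalerAr mulr1.
Qed.

Definition dual_scale (a : R^c) (f : dual M) : dual M :=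
  LinMap (dual_scale_subproof a f).

Fact dual_scalerA a b f : dual_scale a (dual_scale b f) = dual_scale (a * b) f.
Proof. by apply/val_inj/funext => x /=; rewrite scalerA. Qed.
Fact dual_scale1r : left_id 1 dual_scale.
Proof. by move=> f; apply/val_inj/funext => x /=; rewrite scale1r. Qed.
Fact dual_scalerDr : right_distributive dual_scale +%R.
Proof. by move=> a f g; apply/val_inj/funext. Qed.
Fact dual_scalerDl f : {morph dual_scale^~ f : a b / a + b}.
Proof.
by move=> a b; apply/val_inj/funext => x /=; rewrite scalerDl linearD.
Qed.

HB.instance Definition _ := GRing.Zmodule_isLmodule.Build R^c (dual M)
  dual_scalerA dual_scale1r dual_scalerDr dual_scalerDl.

End Duality.

(* P^* = Hom_R(P, R), with (a f)(x) = f(x) a for a : R^c *)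
Section Star.
Variable R : pzRingType.

Definition star (P : lmodType R) : Type := linmap P R^o.
HB.instance Definition _ (P : lmodType R) := GRing.Zmodule.on (star P).

Variable P : lmodType R.

Fact star_scale_subproof (a : R^c) (f : star P) :
  `[< linear (fun x : P => (f x : R) * (a : R) : R^o) >].
Proof.
apply/asboolP => r x y; rewrite linearP mulrDl; congr (_ + _).
by rewrite -[in LHS]/(r * f x) -mulrA.
Qed.

Definition star_scale (a : R^c) (f : star P) : star P :=
  LinMap (star_scale_subproof a f).

Fact star_scalerA a b f : star_scale a (star_scale b f) = star_scale (a * b) f.
Proof. by apply/val_inj/funext => x /=; rewrite -mulrA. Qed.
Fact star_scale1r : left_id 1 star_scale.
Proof. by move=> f; apply/val_inj/funext => x /=; rewrite mulr1. Qed.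
Fact star_scalerDr : right_distributive star_scale +%R.
Proof. by move=> a f g; apply/val_inj/funext => x /=; rewrite mulrDl. Qed.
Fact star_scalerDl f : {morph star_scale^~ f : a b / a + b}.
Proof. by move=> a b; apply/val_inj/funext => x /=; rewrite mulrDr. Qed.

HB.instance Definition _ := GRing.Zmodule_isLmodule.Build R^c (star P)
  star_scalerA star_scale1r star_scalerDr star_scalerDl.

End Star.

(* R^c^c and R have the same elements and the same operations, but the two
   ring structures are not convertible; [unop] reads a module over R^c^c as a
   module over R. *)
Section DoubleOpposite.
Variable R : pzRingType.

Definition unop (M : lmodType R^c^c) : Type := M.
HB.instance Definition _ (M : lmodType R^c^c) := GRing.Zmodule.on (unop M).

Variable M : lmodType R^c^c.
Let scale (a : R) (x : unop M) : unop M := (a : R^c^c) *: (x : M).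

Fact unop_scalerA a b x : scale a (scale b x) = scale (a * b) x.
Proof. exact: (@scalerA R^c^c M). Qed.
Fact unop_scale1r : left_id 1 scale.
Proof. exact: (@scale1r R^c^c M). Qed.
Fact unop_scalerDr : right_distributive scale +%R.
Proof. exact: (@scalerDr R^c^c M). Qed.
Fact unop_scalerDl x : {morph scale^~ x : a b / a + b}.
Proof. exact: (@scalerDl R^c^c M). Qed.

HB.instance Definition _ := GRing.Zmodule_isLmodule.Build R (unop M)
  unop_scalerA unop_scale1r unop_scalerDr unop_scalerDl.

End DoubleOpposite.

(* T is isomorphic to Tr M: there are a minimal projective presentation
   P1 -> P0 -> M -> 0 and an exact sequence P0^* -> P1^* -> T -> 0. *)
Definition is_transpose (R : pzRingType) (M : lmodType R) (T : lmodType R^c)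
    : Prop :=
  exists (P1 P0 : lmodType R) (p1 : {linear P1 -> P0}) (p0 : {linear P0 -> M}),
    minimal_projective_presentation p1 p0 /\
    exists q : {linear star P1 -> T},
      surjective q /\
      forall h : star P1,
        q h = 0 <-> exists g : star P0, forall x, h x = g (p1 x).

Section BalancedPairs.
Variables (K : fieldType) (R : algType K).

(* N is isomorphic to tau M = D Tr M *)
Definition is_tau (M N : lmodType R) : Prop :=
  exists T : lmodType R^c, is_transpose M T /\ isomorphic N (unop (dual T)).

(* N is isomorphic to tau^-1 M = Tr D M *)
Definition is_tau_inv (M N : lmodType R) : Prop :=
  exists T : lmodType R^c^c,
    is_transpose (dual M) T /\ isomorphic N (unop T).

Definition balanced_pair (A B : lmodType R) : Prop :=
  [/\ fin_gen A, fin_gen B, hom_zero A B,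
      exists tA I : lmodType R,
        [/\ is_tau A tA, injective_module I & isomorphic B (tA * I)%type] &
      exists tB P : lmodType R,
        [/\ is_tau_inv B tB, projective P & isomorphic A (tB * P)%type]].

End BalancedPairs.

Definition jasso (R : pzRingType) (A B X : lmodType R) : Prop :=
  [/\ fin_gen X, hom_zero A X & hom_zero X B].

(* Main.v *)
Require Import Defs.
From HB Require Import structures.
From mathcomp Require Import all_boot all_order all_algebra all_field.
From mathcomp Require Import boolp functions.

(** The duality D is a contravariant equivalence on finite dimensional modules,
    so Hom(M, N) vanishes exactly when Hom(DN, DM) does.  Taking (M, N) to be
    (A, X) and (X, B), the two orthogonality conditions that define J(A/B) turn
    into the two that define J(DB/DA), in the opposite order.

    All linear algebra goes through finite systems of vectors [e] and linear
    forms [c] with x = sum_i c_i(x) e_i, which a finitely generated module over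
    a finite dimensional algebra has over the ground field
    ([fin_gen_dual_system], [fin_gen_restrict_scalars]).  Such a system shows
    that linear forms separate points, so that D is faithful, and that every
    linear form on DN is the evaluation at a point of N ([dual_reflexive]), so
    that D is full; [hom_zero_dual] combines both.  It also shows that the [c]
    generate DN, so that DN is finitely generated ([fin_gen_dual]). *)

Set Implicit Arguments.
Unset Strict Implicit.
Unset Printing Implicit Defensive.

Import GRing.Theory.
Local Open Scope ring_scope.

Lemma fin_gen_fintype (R : pzRingType) (M : lmodType R) (I : finType)
    (g : I -> M) :
  (forall x, exists a : I -> R, x = \sum_i a i *: g i) -> fin_gen M.
Proof.
move=> gP; exists #|I|, (fun k => g (enum_val k)) => x.
have [a ->] := gP x; exists (fun k => a (enum_val k)).
exact: (reindex _ (onW_bij _ (@enum_val_bij I))).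
Qed.

(** A generator occurring in a linear relation with a nonzero, hence
    invertible, coefficient can be expressed by the others. *)
Lemma span_drop_dependent (K : fieldType) (V : lmodType K) n
    (e : 'I_n.+1 -> V) (b : 'I_n.+1 -> K) (j : 'I_n.+1) :
  (forall x, exists a : 'I_n.+1 -> K, x = \sum_i a i *: e i) ->
  \sum_i b i *: e i = 0 -> b j != 0 ->
  forall x, exists a : 'I_n -> K, x = \sum_i a i *: e (lift j i).
Proof.
move=> eP b0 bj x; have [a ->] := eP x.
exists (fun i => a (lift j i) - a j / b j * b (lift j i)).
transitivity (\sum_i a i *: e i - a j / b j *: \sum_i b i *: e i).
  by rewrite b0 scaler0 subr0.
rewrite scaler_sumr -sumrB.
rewrite (bigD1_ord j) //= scalerA divfK // subrr add0r.
by apply: eq_bigr => i _; rewrite scalerA scalerBl.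
Qed.

(** A generating family of least size is a basis, and its coordinate functions
    are linear because coordinates are unique. *)
Lemma fin_gen_dual_system (K : fieldType) (V : lmodType K) :
  fin_gen V ->
  exists n (e : 'I_n -> V) (c : 'I_n -> linmap V K^o),
    forall x, x = \sum_i (c i x : K) *: e i.
Proof.
move=> [m genV].
pose spans n := exists e : 'I_n -> V,
  forall x, exists a : 'I_n -> K, x = \sum_i a i *: e i.
have exn : exists n, `[< spans n >] by exists m; apply/asboolP.
case: (ex_minnP exn) => n /asboolP[e eP] n_min.
have e_free (b : 'I_n -> K) : \sum_i b i *: e i = 0 -> forall i, b i = 0.
  move=> b0 j; apply/eqP/negP => /negP bj.
  case: n => [|n] in e eP n_min b b0 j bj *; first by case: j {bj}.
  have /n_min : `[< spans n >].
    apply/asboolP; exists (fun i => e (lift j i)).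
    exact: span_drop_dependent eP b0 bj.
  by rewrite ltnn.
have [c cP] := choice eP.
have c_lin i : `[< linear (fun x => c x i : K^o) >].
  apply/asboolP => k x y; apply/eqP; rewrite -subr_eq0; apply/eqP.
  apply: (e_free (fun i => c (k *: x + y) i - (k * c x i + c y i))).
  under eq_bigr do rewrite scalerBl scalerDl -scalerA.
  by rewrite sumrB big_split /= -scaler_sumr -!cP subrr.
by exists n, e, (fun i => LinMap (c_lin i)).
Qed.

(** The products of the elements of a basis of the algebra with the generators
    of the module span the module over the ground field. *)
Lemma fin_gen_restrict_scalars (K : fieldType) (R : falgType K)
    (M : lmodType R) : fin_gen M -> fin_gen (restrict_scalars M).
Proof.
move=> [n [g gP]]; pose E := vbasis (fullv : {vspace R}).
apply: (@fin_gen_fintype K (restrict_scalars M) _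
  (fun ij : 'I_n * 'I_(\dim (fullv : {vspace R})) => E`_ij.2 *: g ij.1)).
move=> x; have [a ->] := gP x; exists (fun ij => coord E ij.2 (a ij.1)).
rewrite -(pair_bigA _ (fun i j => coord E j (a i) *:
  (E`_j *: g i : restrict_scalars M))) /=.
apply: eq_bigr => i _; rewrite {1}(coord_vbasis (memvf (a i))) scaler_suml.
apply: eq_bigr => j _.
change (coord E j (a i) *: E`_j *: g i
  = (coord E j (a i))%:A *: (E`_j *: g i)).
by rewrite scalerA -scalerAl mul1r.
Qed.

Section Duality.
Variables (K : fieldType) (R : algType K).

(** The ground field acts on the dual through R^c, and this agrees with its
    action on the values of a linear form. *)
Lemma dual_scale_const (M : lmodType R) (k : K) (h : dual M) x :
  (((k%:A : R^c) *: h : dual M) x : K) = k * h x.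
Proof. exact: (linearZ_LR (h : linmap (restrict_scalars M) K^o) k x). Qed.

Lemma dual_sum (M : lmodType R) n (h : 'I_n -> dual M) x :
  ((\sum_i h i : dual M) x : K) = \sum_i (h i x : K).
Proof. by elim/big_ind2: _ => // [f a g b <- <-]. Qed.

Section DualSystem.
Variables (N : lmodType R) (n : nat) (e : 'I_n -> N) (c : 'I_n -> dual N).
Hypothesis ecP : forall x : restrict_scalars N,
  x = \sum_i (c i x : K) *: (e i : restrict_scalars N).

Lemma dual_expand (h : dual N) :
  h = \sum_i ((h (e i) : K)%:A : R^c) *: c i.
Proof.
apply/val_inj/funext => x /=; rewrite dual_sum.
under eq_bigr do rewrite dual_scale_const.
rewrite [in LHS](ecP x) (linear_sum (h : linmap (restrict_scalars N) K^o)).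
apply: eq_bigr => i _.
by rewrite (linearZ_LR (h : linmap (restrict_scalars N) K^o)) mulrC.
Qed.

Lemma dual_separates x : (forall h : dual N, h x = 0) -> x = 0.
Proof.
move=> hx; rewrite [LHS](ecP x) big1 // => i _.
by rewrite hx scale0r.
Qed.

(** Since the [c i] generate the dual, a form [phi] on it agrees with the
    evaluation at the vector whose coordinates are the [phi (c i)]. *)
Lemma dual_reflexive (phi : {linear @restrict_scalars K R^c (dual N) -> K^o}) :
  exists x, forall h : dual N, phi h = h x.
Proof.
exists (\sum_i (phi (c i) : K) *: (e i : restrict_scalars N)) => h.
rewrite (linear_sum (h : linmap (restrict_scalars N) K^o)).
rewrite [in LHS](dual_expand h).
rewrite (linear_sum phi); apply: eq_bigr => i _.
rewrite (linearZ_LR phi (h (e i)) (c i)).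
rewrite (linearZ_LR (h : linmap (restrict_scalars N) K^o)).
exact: (mulrC (h (e i) : K)).
Qed.

End DualSystem.

Lemma dual_map (M N : lmodType R) (f : {linear M -> N}) :
  exists g : {linear dual N -> dual M}, forall h x, g h x = h (f x).
Proof.
have hf_lin (h : dual N) :
    `[< linear (fun x : restrict_scalars M => h (f x) : K^o) >].
  apply/asboolP => k x y.
  rewrite -(linearP (h : linmap (restrict_scalars N) K^o)).
  by congr (linmap_fun h _); exact: (linearP f).
pose g (h : dual N) : dual M := LinMap (hf_lin h).
have g_lin : linear g.
  move=> a h h'; apply/val_inj/funext => x /=.
  rewrite -[LHS]/((h ((a : R) *: (f x : N)) : K) + h' (f x)).
  by rewrite -[RHS]/((h (f ((a : R) *: (x : M))) : K) + h' (f x)) linearZ.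
pose gL := GRing.isLinear.Build _ _ _ _ g g_lin.
pose G : {linear dual N -> dual M} := HB.pack g gL.
by exists G.
Qed.

End Duality.

Lemma fin_gen_dual (K : fieldType) (R : falgType K) (N : lmodType R) :
  fin_gen N -> fin_gen (dual N).
Proof.
move=> /fin_gen_restrict_scalars/fin_gen_dual_system[n [e [c ecP]]].
exists n, c => h; exists (fun i => (h (e i) : K)%:A : R^c).
exact: dual_expand.
Qed.

(** If Hom(M, N) = 0, a map g : DN -> DM sends h to (h o f), where f(m) is the
    point of N at which h |-> g(h)(m) evaluates; separation of points makes f
    linear, so f, and with it g, is zero.  The converse is faithfulness. *)
Lemma hom_zero_dual (K : fieldType) (R : falgType K) (M N : lmodType R) :
  fin_gen N -> hom_zero M N <-> hom_zero (dual N) (dual M).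
Proof.
move=> /fin_gen_restrict_scalars/fin_gen_dual_system[n [e [c ecP]]].
split=> [MN0 g h | DND0 f x]; last first.
  have [g gP] := dual_map f; apply: (dual_separates ecP) => h.
  by rewrite -gP DND0.
have evalP (m : M) : exists x : N, forall h : dual N, g h m = h x.
  pose phi (h : @restrict_scalars K R^c (dual N)) : K^o := g h m.
  have phi_lin : linear phi.
    move=> k h1 h2; rewrite /phi.
    have -> : g (k *: h1 + h2) = (k%:A : R^c) *: g h1 + g h2 by exact: linearP.
    by rewrite -[LHS]/((((k%:A : R^c) *: g h1 : dual M) m : K) + g h2 m)
      dual_scale_const.
  pose phiL := GRing.isLinear.Build _ _ _ _ phi phi_lin.
  pose Phi : {linear @restrict_scalars K R^c (dual N) -> K^o} := HB.pack phi phiL.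
  exact: (dual_reflexive ecP Phi).
have [f fP] := choice evalP.
have f_lin : linear f.
  move=> a x y; apply/eqP; rewrite -subr_eq0; apply/eqP.
  apply: (dual_separates ecP) => h1.
  have -> : h1 (f (a *: x + y) - (a *: f x + f y))
      = (h1 (f (a *: x + y)) : K) - ((h1 (a *: f x) : K) + h1 (f y)).
    rewrite (linearB (h1 : linmap (restrict_scalars N) K^o)).
    by rewrite (linearD (h1 : linmap (restrict_scalars N) K^o)).
  have -> : h1 (f (a *: x + y)) = (g h1 (a *: x) : K) + h1 (f y).
    by rewrite -!fP (linearD (g h1 : linmap (restrict_scalars M) K^o)).
  (* The scalar [a] moves through [h1] and [g h1] as the action of R^c. *)
  have -> : h1 (a *: f x) = g h1 (a *: x).
    by rewrite -[LHS]/(((a : R^c) *: h1 : dual N) (f x)) -fP linearZ.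
  exact: subrr.
pose fL := GRing.isLinear.Build _ _ _ _ f f_lin.
pose F : {linear M -> N} := HB.pack f fL.
apply/val_inj/funext => m; rewrite /= fP.
have -> : f m = 0 by exact: (MN0 F).
exact: (linear0 (h : linmap (restrict_scalars N) K^o)).
Qed.

Theorem lemma7p4 (K : fieldType) (Lambda : falgType K)
  (A B : lmodType Lambda^c) (hAB : balanced_pair A B)
  (X : lmodType Lambda^c) (hX : fin_gen X) :
  jasso A B X <-> jasso (dual B) (dual A) (dual X).
Proof.
have [_ fgB _ _ _] := hAB.
have AX := hom_zero_dual A hX; have XB := hom_zero_dual X fgB.
split=> [[_ /AX AX0 /XB XB0] | [_ /XB XB0 /AX AX0]]; split=> //.
exact: fin_gen_dual.
Qed.
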